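(* Let $\ell_p^*=\frac{n-p}{p-1}$. Assume that there are constants $A,B>0$, $\ell$ with $0<\ell<\ell_p^*$, and a function $h$ such that $\mathcal{K}(r)=A+Br^{\ell}+h(r)$ and $\lim_{r\to 0}\frac{|h(r)|+r|h'(r)|}{r^{\ell}}=0$. Then there exists $\hat D>0$ such that $(\hat D,+\infty)\subset J$ and $\lim_{d\to+\infty}R(d)=0$.
   Context: Standing assumptions: $n$ is a positive integer, $p$ is real with $1<p<n$ and $\frac{2n}{n+2}\le p\le 2$, $q=\frac{np}{n-p}$, and $\mathcal{K}:[0,+\infty)\to(0,+\infty)$ is $C^1$. For each $d>0$, $u(r;d)$ denotes the unique (regular) solution of $(r^{n-1}u'|u'|^{p-2})'+r^{n-1}\mathcal{K}(r)u|u|^{q-2}=0$ with $\lim_{r\to0}u(r;d)=d$ (it satisfies $u'(0;d)=0$). $J$ is the set of $d>0$ such that $u(\cdot;d)$ is a crossing solution, i.e. has a zero at some finite positive $r$, and for $d\in J$, $R(d)>0$ denotes the first zero of $u(\cdot;d)$. *)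

(* Defs.v *)
(* Stdlib reals with Coquelicot. *)
From Stdlib Require Import Reals ClassicalEpsilon.
From Coquelicot Require Import Coquelicot.
Open Scope R_scope.

(* The one-sided derivative is taken at boundary points of [D]. *)
Definition C1_on (D : R -> Prop) (f : R -> R) : Prop :=
  exists f' : R -> R, forall r, D r -> D_in f f' D r /\ continue_in f' D r.

(* [x |x|^(m-2)].  Stdlib has [Rpower 0 y = 1]; the factor [x] gives the usual
   value [0] at [x = 0], also for [m < 2]. *)
Definition signed_pow (m x : R) : R := x * Rpower (Rabs x) (m - 2).

Definition critical_exponent (n : nat) (p : R) : R := INR n * p / (INR n - p).

(* [(r^(n-1) u'|u'|^(p-2))' + r^(n-1) K(r) u|u|^(q-2) = 0] on [(0, +oo)], with
   [u(r) -> d] as [r -> 0+].  The value [u 0] plays no role.  [u'(0) = 0] is a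
   consequence when [1 < p < n]: a nonzero limit of [r^(n-1) u'|u'|^(p-2)] at
   [0] would make [u] unbounded near [0]. *)
Definition regular_solution (n : nat) (p : R) (K : R -> R) (d : R) (u : R -> R)
  : Prop :=
  (forall r, 0 < r -> ex_derive u r) /\
  (forall r, 0 < r ->
     ex_derive (fun s => s ^ (n - 1) * signed_pow p (Derive u s)) r /\
     Derive (fun s => s ^ (n - 1) * signed_pow p (Derive u s)) r
     + r ^ (n - 1) * K r * signed_pow (critical_exponent n p) (u r) = 0) /\
  filterlim u (at_right 0) (locally d).

(* The set [J], for a family [u d = u(.;d)]. *)
Definition crossing_set (u : R -> R -> R) (d : R) : Prop :=
  0 < d /\ exists r, 0 < r /\ u d r = 0.

Definition is_first_zero (v : R -> R) (r : R) : Prop :=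
  0 < r /\ v r = 0 /\ forall s, 0 < s < r -> v s <> 0.

(* [R(d)]; unspecified when [u d] has no first zero, in particular off [J]. *)
Definition first_zero (u : R -> R -> R) (d : R) : R :=
  epsilon (inhabits 0) (is_first_zero (u d)).

(* Main.v *)
(* Suppose u = u(.;d) has no zero on (0,rho].  After the dilation
   s = r d^(p/(n-p)) and division by d, u takes the value 1 at the origin, K is
   dilated, and the interval becomes (0,S] with S = rho d^(p/(n-p)).  Since K
   increases near 0, the Pohozaev function is nonnegative, which is equivalent
   to the monotonicity of F u^(-n(p-1)/(n-p)) s^(-n), where F is the flux
   -s^(n-1) u'|u'|^(p-2) (this quotient is constant on the Aubin-Talenti
   bubbles).  Hence u lies below a bubble: u <= C s^(-(n-p)/(p-1)), and F is
   bounded.  The Pohozaev function at S is then at most C S^(-(n-p)/(p-1)), whereas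
   the core of the profile makes it at least a constant times S^(-l); this is
   impossible for large d because l < (n-p)/(p-1). *)
Require Import Defs.
From Stdlib Require Import Reals Lra Lia Classical ClassicalEpsilon Ranalysis5.
From Coquelicot Require Import Coquelicot.
Open Scope R_scope.

(** * Derivative rules and inequalities for real powers *)

Lemma is_derive_eq (f : R -> R) (x l l' : R) :
  is_derive f x l -> l = l' -> is_derive f x l'.
Proof. intros H <-; exact H. Qed.

Lemma is_derive_Rmult (f g : R -> R) (x df dg : R) :
  is_derive f x df -> is_derive g x dg ->
  is_derive (fun y => f y * g y) x (df * g x + f x * dg).
Proof. intros Hf Hg; apply (is_derive_mult f g x df dg Hf Hg Rmult_comm). Qed.

Lemma is_derive_Rplus (f g : R -> R) (x df dg : R) :
  is_derive f x df -> is_derive g x dg ->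
  is_derive (fun y => f y + g y) x (df + dg).
Proof. intros Hf Hg; apply (is_derive_plus f g x df dg Hf Hg). Qed.

Lemma is_derive_Rminus (f g : R -> R) (x df dg : R) :
  is_derive f x df -> is_derive g x dg ->
  is_derive (fun y => f y - g y) x (df - dg).
Proof. intros Hf Hg; apply (is_derive_minus f g x df dg Hf Hg). Qed.

Lemma is_derive_Rpower (f : R -> R) (x df b : R) :
  is_derive f x df -> 0 < f x ->
  is_derive (fun y => Rpower (f y) b) x (b * (Rpower (f x) b / f x) * df).
Proof.
  intros Hf Hx.
  assert (Hp : is_derive (fun y => Rpower y b) (f x) (b * Rpower (f x) (b - 1)))
    by (apply is_derive_Reals, derivable_pt_lim_power, Hx).
  eapply is_derive_eq; [exact (is_derive_comp _ f x _ _ Hp Hf)|].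
  unfold scal; simpl; unfold mult; simpl.
  unfold Rminus; rewrite Rpower_plus, Rpower_Ropp, Rpower_1 by exact Hx.
  field; lra.
Qed.

Lemma is_derive_Rpower_id (x b : R) :
  0 < x -> is_derive (fun y => Rpower y b) x (b * (Rpower x b / x)).
Proof.
  intros Hx; eapply is_derive_eq;
    [apply (is_derive_Rpower (fun y => y)); [apply is_derive_id|exact Hx]|].
  unfold one; simpl; ring.
Qed.

Lemma is_derive_Rscal (c : R) (f : R -> R) (x df : R) :
  is_derive f x df -> is_derive (fun y => c * f y) x (c * df).
Proof. intros Hf; apply (is_derive_scal f x c df Hf). Qed.

Lemma Rpower_pos (x b : R) : 0 < Rpower x b.
Proof. apply exp_pos. Qed.

(** Used to rewrite neighbouring powers over one common power, after which identities between
    derivatives become rational and fall to [field]. *)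
Lemma Rpower_pred (s b : R) : 0 < s -> Rpower s b = s * Rpower s (b - 1).
Proof.
  intros Hs; replace (s * Rpower s (b - 1)) with (Rpower s 1 * Rpower s (b - 1))
    by (rewrite Rpower_1; auto).
  rewrite <- Rpower_plus; f_equal; ring.
Qed.

Lemma Rpower_base_mult (x y b : R) :
  0 < x -> 0 < y -> Rpower (x * y) b = Rpower x b * Rpower y b.
Proof. intros; symmetry; apply Rpower_mult_distr; assumption. Qed.

Lemma Rpower_le_neg (x y b : R) :
  b <= 0 -> 0 < x <= y -> Rpower y b <= Rpower x b.
Proof.
  intros Hb Hxy; replace b with (- - b) by ring; rewrite !(Rpower_Ropp _ (- b)).
  apply Rinv_le_contravar; [apply Rpower_pos|apply Rle_Rpower_l; lra].
Qed.

Lemma Rpower_le_1 (x b : R) : 0 <= b -> 0 < x <= 1 -> Rpower x b <= 1.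
Proof.
  intros Hb Hx; rewrite <- (exp_0); unfold Rpower.
  assert (Hl : ln x <= 0) by (rewrite <- ln_1; apply ln_le; lra).
  assert (Hbl : b * ln x <= 0) by nra.
  destruct Hbl as [Hbl|Hbl]; [left; apply exp_increasing, Hbl|rewrite Hbl; right; reflexivity].
Qed.

Lemma Rpower_decr_exp (x b c : R) : b <= c -> 0 < x <= 1 -> Rpower x c <= Rpower x b.
Proof.
  intros Hbc Hx; replace c with (b + (c - b)) by ring; rewrite Rpower_plus.
  assert (H := Rpower_le_1 x (c - b) ltac:(lra) Hx).
  assert (H1 := Rpower_pos x b); nra.
Qed.

(** * Monotonicity and one-sided limits at the origin *)

Lemma deriv_nonneg_le (f df : R -> R) (a b : R) :
  a <= b ->
  (forall x, a <= x <= b -> is_derive f x (df x)) ->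
  (forall x, a <= x <= b -> 0 <= df x) -> f a <= f b.
Proof.
  intros Hab Hd Hp.
  destruct (MVT_gen f a b df) as [c [Hc Heq]].
  - rewrite Rmin_left, Rmax_right by exact Hab; intros x Hx; apply Hd; lra.
  - rewrite Rmin_left, Rmax_right by exact Hab; intros x Hx.
    apply derivable_continuous_pt; exists (df x); apply is_derive_Reals, Hd, Hx.
  - rewrite Rmin_left, Rmax_right in Hc by exact Hab.
    specialize (Hp c Hc); nra.
Qed.

Lemma deriv_pos_lt (f df : R -> R) (a b : R) :
  a < b ->
  (forall x, a <= x <= b -> is_derive f x (df x)) ->
  (forall x, a <= x <= b -> 0 < df x) -> f a < f b.
Proof.
  intros Hab Hd Hp.
  destruct (MVT_gen f a b df) as [c [Hc Heq]].
  - rewrite Rmin_left, Rmax_right by lra; intros x Hx; apply Hd; lra.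
  - rewrite Rmin_left, Rmax_right by lra; intros x Hx.
    apply derivable_continuous_pt; exists (df x); apply is_derive_Reals, Hd, Hx.
  - rewrite Rmin_left, Rmax_right in Hc by lra.
    specialize (Hp c Hc); nra.
Qed.

Lemma at_right_0_between (Q : R -> Prop) (r : R) :
  0 < r -> at_right 0 Q -> exists s, 0 < s <= r /\ Q s.
Proof.
  intros Hr [e He].
  assert (H0 := cond_pos e).
  exists (Rmin r (e / 2)).
  assert (H1 := Rmin_l r (e / 2)). assert (H2 := Rmin_r r (e / 2)).
  assert (H3 : 0 < Rmin r (e / 2)) by (apply Rmin_glb_lt; lra).
  split; [lra|].
  apply He; [|exact H3].
  change (Rabs (Rmin r (e / 2) - 0) < e); rewrite Rabs_pos_eq; lra.
Qed.

(** Plays the role of integration from [0]: [f] is nondecreasing, so [f r] dominates the values of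
    [g] near the origin. A limit is required of the minorant [g] alone, so [f] may contain terms
    whose behaviour at [0] has not been studied. *)
Lemma limit_le_of_deriv_nonneg (f df g : R -> R) (lim r : R) :
  0 < r ->
  (forall s, 0 < s <= r -> is_derive f s (df s)) ->
  (forall s, 0 < s <= r -> 0 <= df s) ->
  (forall s, 0 < s <= r -> g s <= f s) ->
  filterlim g (at_right 0) (locally lim) -> lim <= f r.
Proof.
  intros Hr Hd Hp Hg Hlim.
  apply Rnot_lt_le; intros Hlt.
  assert (He : 0 < lim - f r) by lra.
  destruct (at_right_0_between _ r Hr
    (proj1 (filterlim_locally g lim) Hlim (mkposreal _ He))) as [s [Hs Hb]].
  change (Rabs (g s - lim) < lim - f r) in Hb; apply Rabs_def2 in Hb.
  assert (Hm : f s <= f r).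
  { apply (deriv_nonneg_le f df); [lra| |]; intros x Hx; [apply Hd|apply Hp]; lra. }
  specialize (Hg s Hs); lra.
Qed.

Lemma filterlim_opp (f : R -> R) (x : R) :
  filterlim f (at_right 0) (locally x) ->
  filterlim (fun s => - f s) (at_right 0) (locally (- x)).
Proof.
  intros H; eapply filterlim_comp; [exact H|apply (filterlim_opp x)].
Qed.

(** Supplies minorants with limit [0] for the integrations from the origin. *)
Lemma filterlim_neg_Rpower (c b : R) :
  0 < b -> filterlim (fun s => - (c * Rpower s b)) (at_right 0) (locally 0).
Proof.
  intros Hb; apply filterlim_locally; intros [e He].
  set (c1 := Rabs c + 1). assert (Hc := Rabs_pos c).
  exists (mkposreal _ (Rpower_pos (e / c1) (/ b))); intros s Hs Hs0.
  change (Rabs (s - 0) < Rpower (e / c1) (/ b)) in Hs.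
  rewrite Rminus_0_r, Rabs_pos_eq in Hs by lra.
  change (Rabs (- (c * Rpower s b) - 0) < e).
  rewrite Rminus_0_r, Rabs_Ropp, Rabs_mult, (Rabs_pos_eq (Rpower s b))
    by (left; apply Rpower_pos).
  assert (H : Rpower s b < e / c1).
  { replace (e / c1) with (Rpower (Rpower (e / c1) (/ b)) b).
    - apply Rlt_Rpower_l; lra.
    - rewrite Rpower_mult, Rinv_l, Rpower_1; try lra.
      apply Rdiv_lt_0_compat; unfold c1; lra. }
  apply Rmult_lt_compat_r with (r := c1) in H; [|unfold c1; lra].
  replace (e / c1 * c1) with e in H by (field; unfold c1; lra).
  assert (Hp := Rpower_pos s b); unfold c1 in H; nra.
Qed.

(** * Normalized profiles: exponents and uniform constants *)

Section Normalized.

Variables N p A M l : R.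
Hypothesis hp : 1 < p.
Hypothesis hpN : p < N.
Hypothesis hA : 0 < A.
Hypothesis hAM : A <= M.
Hypothesis hl : 0 < l.

Let a := / (p - 1).
Let q := N * p / (N - p).

Lemma inv_p1_pos : 0 < a.
Proof. apply Rinv_0_lt_compat; lra. Qed.

Lemma q_gt_p : p < q.
Proof.
  unfold q; apply Rmult_lt_reg_r with (N - p); [lra|].
  replace (N * p / (N - p) * (N - p)) with (N * p) by (field; lra); nra.
Qed.

(* [eps] is small enough for [u >= 1/2] on [(0, eps]]; [c1], [c2], [c3] bound from
   below [G], the Pohozaev function at [S] divided by [kappa], and the slope of
   [u^(-p/(N-p))] in [s^(a+1)]; [C1] and [C2] bound [u s^((N-p)a)] and [F]. *)
Let M1 := Rpower (M / N) a.
Let eps := Rmin 1 (/ (2 * M1)).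
Let c1 := A * Rpower (/ 2) (q - 1) / N.
Let c2 := Rpower eps (N + l) * Rpower (/ 2) q / (q * (N + l)).
Let c3 := p / (N - p) * Rpower c1 a / (a + 1).
Let C1 := Rpower c3 (- ((N - p) / p)).
Let C2 := M / N * Rpower eps N
          + M * Rpower C1 (q - 1) / (p * a) * Rpower eps (- (p * a)).

Lemma eps_pos : 0 < eps.
Proof.
  assert (H := Rpower_pos (M / N) a).
  apply Rmin_glb_lt; [lra|apply Rinv_0_lt_compat; unfold M1; lra].
Qed.

Lemma eps_le_1 : eps <= 1.
Proof. apply Rmin_l. Qed.

Lemma M1_eps : M1 * eps <= / 2.
Proof.
  assert (H := Rpower_pos (M / N) a); fold M1 in H.
  apply Rle_trans with (M1 * / (2 * M1)).
  - apply Rmult_le_compat_l; [lra|apply Rmin_r].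
  - right; field; lra.
Qed.

Lemma c1_pos : 0 < c1.
Proof.
  assert (H := Rpower_pos (/ 2) (q - 1)).
  apply Rdiv_lt_0_compat; nra.
Qed.

Lemma c2_pos : 0 < c2.
Proof.
  assert (Hq := q_gt_p).
  apply Rdiv_lt_0_compat; apply Rmult_lt_0_compat; try apply Rpower_pos; lra.
Qed.

Lemma c3_pos : 0 < c3.
Proof.
  assert (Ha := inv_p1_pos).
  apply Rdiv_lt_0_compat; [apply Rmult_lt_0_compat;
    [apply Rdiv_lt_0_compat; lra|apply Rpower_pos]|lra].
Qed.

(** * A profile on [(0, S]] and its bounds near the origin *)

Section Profile.

Variables (S kappa : R) (u F K K' : R -> R).

(** This is [-u'], recovered from the flux [F = s^(N-1) |u'|^(p-1)]; the second-order equation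
    becomes a first-order system in [u] and [F]. *)
Let w (s : R) := Rpower (F s * Rpower s (1 - N)) a.

Hypothesis hS : 1 <= S.
Hypothesis hkappa : 0 < kappa.
Hypothesis hu : forall s, 0 < s <= S ->
  is_derive u s (- Rpower (F s * Rpower s (1 - N)) (/ (p - 1))).
Hypothesis hF : forall s, 0 < s <= S ->
  is_derive F s (Rpower s (N - 1) * K s * Rpower (u s) (N * p / (N - p) - 1)).
Hypothesis hK : forall s, 0 < s <= S -> is_derive K s (K' s).
Hypothesis u_pos : forall s, 0 < s <= S -> 0 < u s.
Hypothesis F_pos : forall s, 0 < s <= S -> 0 < F s.
Hypothesis K_bounds : forall s, 0 < s <= S -> A <= K s <= M.
Hypothesis K'_lower : forall s, 0 < s <= S -> kappa * Rpower s (l - 1) <= K' s.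
Hypothesis u_lim : filterlim u (at_right 0) (locally 1).
Hypothesis F_lim : filterlim F (at_right 0) (locally 0).

Lemma w_pos (s : R) : 0 < w s.
Proof. apply Rpower_pos. Qed.

Lemma profile_le_1 (s : R) : 0 < s <= S -> u s <= 1.
Proof.
  intros Hs; apply Ropp_le_cancel.
  apply (limit_le_of_deriv_nonneg (fun x => - u x) w (fun x => - u x)); try lra.
  - intros x Hx; eapply is_derive_eq; [apply (is_derive_opp u), hu; lra|].
    apply Ropp_involutive.
  - intros x _; left; apply w_pos.
  - intros x _; lra.
  - apply filterlim_opp, u_lim.
Qed.

(** Since [u <= 1] and [K <= M], the derivative of [F] is at most [M s^(N-1)], and [F] starts from
    [0]. *)
Lemma flux_le (s : R) : 0 < s <= S -> F s <= M / N * Rpower s N.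
Proof.
  intros Hs.
  cut (0 <= M / N * Rpower s N - F s); [lra|].
  rewrite <- Ropp_0.
  apply (limit_le_of_deriv_nonneg (fun x => M / N * Rpower x N - F x)
    (fun x => Rpower x (N - 1) * (M - K x * Rpower (u x) (q - 1)))
    (fun x => - F x)); try lra.
  - intros x Hx; eapply is_derive_eq.
    + apply is_derive_Rminus;
        [apply is_derive_Rscal, is_derive_Rpower_id; lra|apply hF; lra].
    + fold q; rewrite (Rpower_pred x N) by lra; field; lra.
  - intros x Hx; apply Rmult_le_pos; [left; apply Rpower_pos|].
    assert (Hq := q_gt_p).
    assert (H1 : Rpower (u x) (q - 1) <= 1).
    { apply Rpower_le_1; [lra|split; [apply u_pos|apply profile_le_1]; lra]. }
    assert (H2 := Rpower_pos (u x) (q - 1)).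
    assert (H3 := K_bounds x ltac:(lra)); nra.
  - intros x Hx; assert (H := Rpower_pos x N).
    assert (0 < M / N) by (apply Rdiv_lt_0_compat; lra); nra.
  - apply filterlim_opp, F_lim.
Qed.

Lemma flux_density_le (s : R) : 0 < s <= S -> F s * Rpower s (1 - N) <= M / N * s.
Proof.
  intros Hs.
  apply Rle_trans with (M / N * Rpower s N * Rpower s (1 - N)).
  - apply Rmult_le_compat_r; [left; apply Rpower_pos|apply flux_le, Hs].
  - rewrite Rmult_assoc, <- Rpower_plus; replace (N + (1 - N)) with 1 by ring.
    rewrite Rpower_1 by lra; lra.
Qed.

Lemma slope_le (s : R) : 0 < s <= S -> w s <= M1 * Rpower s a.
Proof.
  intros Hs; assert (Ha := inv_p1_pos).
  unfold M1; rewrite <- Rpower_base_mult; [|apply Rdiv_lt_0_compat; lra|lra].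
  apply Rle_Rpower_l; [lra|split; [|apply flux_density_le, Hs]].
  apply Rmult_lt_0_compat; [apply F_pos, Hs|apply Rpower_pos].
Qed.

(** Integrating [w <= M1 s^a] from the origin gives [u >= 1 - M1 s^(a+1) / (a+1)], and for
    [s <= eps <= 1] the loss is at most [M1 * eps <= 1/2]. *)
Lemma profile_ge_half (s : R) : 0 < s <= eps -> / 2 <= u s.
Proof.
  intros Hs; assert (Ha := inv_p1_pos); assert (He := eps_le_1).
  assert (HM := M1_eps); assert (HM1 := Rpower_pos (M / N) a); fold M1 in HM1.
  assert (H : 1 <= u s + M1 / (a + 1) * Rpower s (a + 1)).
  { apply (limit_le_of_deriv_nonneg
      (fun x => u x + M1 / (a + 1) * Rpower x (a + 1))
      (fun x => M1 * Rpower x a - w x) u); try lra.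
    - intros x Hx; eapply is_derive_eq.
      + apply is_derive_Rplus;
          [apply hu; lra|apply is_derive_Rscal, is_derive_Rpower_id; lra].
      + fold a; fold (w x); rewrite (Rpower_pred x (a + 1)) by lra.
        replace (a + 1 - 1) with a by ring; field; lra.
    - intros x Hx; assert (H := slope_le x ltac:(lra)); lra.
    - intros x Hx; assert (H := Rpower_pos x (a + 1)).
      assert (0 < M1 / (a + 1)) by (apply Rdiv_lt_0_compat; lra); nra.
    - exact u_lim. }
  assert (H1 : Rpower s (a + 1) <= s).
  { rewrite <- (Rpower_1 s) at 2 by lra; apply Rpower_decr_exp; lra. }
  assert (H2 : M1 / (a + 1) <= M1).
  { apply Rmult_le_reg_r with (a + 1); [lra|].
    replace (M1 / (a + 1) * (a + 1)) with M1 by (field; lra); nra. }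
  assert (0 < M1 / (a + 1)) by (apply Rdiv_lt_0_compat; lra).
  assert (H3 : M1 / (a + 1) * Rpower s (a + 1) <= M1 * s)
    by (apply Rmult_le_compat; try lra; left; apply Rpower_pos).
  nra.
Qed.

(** On the core, [K u^(q-1)] is at least [A (1/2)^(q-1) = N c1]; integrate against [s^(N-1)]. *)
Lemma flux_ge (s : R) : 0 < s <= eps -> c1 * Rpower s N <= F s.
Proof.
  intros Hs; assert (Hc := c1_pos); assert (Hq := q_gt_p); assert (He := eps_le_1).
  cut (0 <= F s - c1 * Rpower s N); [lra|].
  apply (limit_le_of_deriv_nonneg (fun x => F x - c1 * Rpower x N)
    (fun x => Rpower x (N - 1) * (K x * Rpower (u x) (q - 1) - A * Rpower (/ 2) (q - 1)))
    (fun x => - (c1 * Rpower x N))); try lra.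
  - intros x Hx; eapply is_derive_eq.
    + apply is_derive_Rminus;
        [apply hF; lra|apply is_derive_Rscal, is_derive_Rpower_id; lra].
    + fold q; rewrite (Rpower_pred x N) by lra; unfold c1; field; lra.
  - intros x Hx; apply Rmult_le_pos; [left; apply Rpower_pos|].
    assert (H1 : Rpower (/ 2) (q - 1) <= Rpower (u x) (q - 1)).
    { apply Rle_Rpower_l; [lra|split; [lra|apply profile_ge_half; lra]]. }
    assert (H2 := Rpower_pos (/ 2) (q - 1)).
    assert (H3 := K_bounds x ltac:(lra)).
    assert (A * Rpower (/ 2) (q - 1) <= K x * Rpower (u x) (q - 1))
      by (apply Rmult_le_compat; lra); lra.
  - intros x Hx; assert (H := F_pos x ltac:(lra)); lra.
  - apply filterlim_neg_Rpower; lra.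
Qed.

(** * The Pohozaev function *)

(** In terms of [u'] this is [(p-1)/p s^N |u'|^p + s^N K u^q / q + (N-p)/p s^(N-1) u u'|u'|^(p-2)],
    because [s F w = s^N |u'|^p] and [1/(1+a) = (p-1)/p]. *)
Let P (s : R) :=
  s * F s * w s / (1 + a) + Rpower s N * K s * Rpower (u s) q / q
  - (N - p) / p * F s * u s.

(** All terms without [K'] cancel: those in [F w] because [a/(1+a) = 1/p], those in [K u^q] because
    [N/q = (N-p)/p], which is where criticality of [q] enters. *)
Lemma is_derive_pohozaev (s : R) :
  0 < s <= S -> is_derive P s (Rpower s N * K' s * Rpower (u s) q / q).
Proof.
  intros Hs; assert (Ha := inv_p1_pos); assert (Hq := q_gt_p).
  assert (HF0 := F_pos s Hs). assert (Hu0 := u_pos s Hs).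
  assert (HX := Rpower_pos s (1 - N)).
  assert (Hw : is_derive w s (a * (w s / (F s * Rpower s (1 - N))) *
     (Rpower s (N - 1) * K s * Rpower (u s) (N * p / (N - p) - 1) * Rpower s (1 - N)
       + F s * ((1 - N) * (Rpower s (1 - N) / s))))).
  { apply (is_derive_Rpower (fun y => F y * Rpower y (1 - N))).
    - apply (is_derive_Rmult F (fun y => Rpower y (1 - N)));
        [apply hF, Hs|apply is_derive_Rpower_id; lra].
    - nra. }
  eapply is_derive_eq.
  - apply is_derive_Rminus; [apply is_derive_Rplus|].
    + apply is_derive_Rmult; [|apply (is_derive_const (/ (1 + a)))].
      apply is_derive_Rmult; [|exact Hw].
      apply is_derive_Rmult; [apply (is_derive_id (K := R_AbsRing))|apply hF, Hs].
    + apply is_derive_Rmult; [|apply (is_derive_const (/ q))].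
      apply is_derive_Rmult; [|apply is_derive_Rpower; [apply hu, Hs|exact Hu0]].
      apply is_derive_Rmult; [apply is_derive_Rpower_id; lra|apply hK, Hs].
    + apply is_derive_Rmult; [|apply hu, Hs].
      apply is_derive_Rscal, hF, Hs.
  - cbv beta; fold a q; fold (w s).
    (* With [u^q = u u^(q-1)] and [s^N = s s^(N-1)] the remaining powers are independent atoms and
       the identity is rational. *)
    rewrite (Rpower_pred (u s) q), (Rpower_pred s N) by lra.
    set (W := w s); set (U := Rpower (u s) (q - 1)); set (Y := Rpower s (N - 1)).
    set (X := Rpower s (1 - N)) in *.
    unfold zero, one; simpl.
    unfold a, q; field; repeat split; try lra; nra.
Qed.

(** A crude minorant that vanishes at the origin: the first two terms of [P] are positive, and [F u]
    is at most [M/N s^N]. *)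
Lemma pohozaev_ge (s : R) :
  0 < s <= S -> - ((N - p) / p * (M / N) * Rpower s N) <= P s.
Proof.
  intros Hs; assert (Ha := inv_p1_pos); assert (Hq := q_gt_p).
  assert (HF0 := F_pos s Hs). assert (Hu0 := u_pos s Hs).
  assert (Hu1 := profile_le_1 s Hs). assert (HFl := flux_le s Hs).
  assert (Hw := w_pos s). assert (HK0 := K_bounds s Hs).
  assert (H1 : 0 < s * F s * w s / (1 + a)).
  { apply Rdiv_lt_0_compat; [|lra]; repeat apply Rmult_lt_0_compat; lra. }
  assert (H2 : 0 < Rpower s N * K s * Rpower (u s) q / q).
  { apply Rdiv_lt_0_compat; [|lra];
      repeat apply Rmult_lt_0_compat; try apply Rpower_pos; lra. }
  assert (H3 : (N - p) / p * F s * u s <= (N - p) / p * (M / N) * Rpower s N).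
  { rewrite !Rmult_assoc; apply Rmult_le_compat_l;
      [left; apply Rdiv_lt_0_compat; lra|nra]. }
  unfold P; lra.
Qed.

Lemma pohozaev_derive_nonneg (s : R) :
  0 < s <= S -> 0 <= Rpower s N * K' s * Rpower (u s) q / q.
Proof.
  intros Hs; assert (Hq := q_gt_p); assert (HK' := K'_lower s Hs).
  assert (H := Rpower_pos s (l - 1)).
  left; apply Rdiv_lt_0_compat; [|lra].
  repeat apply Rmult_lt_0_compat; try apply Rpower_pos; nra.
Qed.

Lemma pohozaev_nonneg (s : R) : 0 < s <= S -> 0 <= P s.
Proof.
  intros Hs.
  apply (limit_le_of_deriv_nonneg P
    (fun x => Rpower x N * K' x * Rpower (u x) q / q)
    (fun x => - ((N - p) / p * (M / N) * Rpower x N))); try lra.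
  - intros x Hx; apply is_derive_pohozaev; lra.
  - intros x Hx; apply pohozaev_derive_nonneg; lra.
  - intros x Hx; apply pohozaev_ge; lra.
  - apply filterlim_neg_Rpower; lra.
Qed.

(** Only the core is integrated: there [u >= 1/2], so [P'] is at least
    [kappa s^(N+l-1) (1/2)^q / q]. From [eps] to [S] it suffices that [P] does not decrease. *)
Lemma pohozaev_lower : kappa * c2 <= P S.
Proof.
  assert (Hq := q_gt_p); assert (He := eps_pos); assert (He1 := eps_le_1).
  apply Rle_trans with (P eps).
  2:{ apply (deriv_nonneg_le P (fun x => Rpower x N * K' x * Rpower (u x) q / q));
        [lra| |]; intros x Hx;
        [apply is_derive_pohozaev|apply pohozaev_derive_nonneg]; lra. }
  set (c := kappa * Rpower (/ 2) q / (q * (N + l))).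
  assert (Hc : 0 < c).
  { apply Rdiv_lt_0_compat; apply Rmult_lt_0_compat; try apply Rpower_pos; lra. }
  replace (kappa * c2) with (c * Rpower eps (N + l))
    by (unfold c, c2; field; lra).
  cut (0 <= P eps - c * Rpower eps (N + l)); [lra|].
  apply (limit_le_of_deriv_nonneg (fun x => P x - c * Rpower x (N + l))
    (fun x => Rpower x N * K' x * Rpower (u x) q / q
              - Rpower x N * (kappa * Rpower x (l - 1)) * Rpower (/ 2) q / q)
    (fun x => - (((N - p) / p * (M / N) + c) * Rpower x N))); try lra.
  - intros x Hx; eapply is_derive_eq.
    + apply is_derive_Rminus;
        [apply is_derive_pohozaev; lra|apply is_derive_Rscal, is_derive_Rpower_id; lra].
    + rewrite (Rpower_plus N l), (Rpower_pred x l) by lra.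
      unfold c; field; lra.
  - intros x Hx.
    assert (HK' := K'_lower x ltac:(lra)).
    assert (H1 := Rpower_pos x (l - 1)).
    assert (H2 : Rpower (/ 2) q <= Rpower (u x) q)
      by (apply Rle_Rpower_l; [lra|split; [lra|apply profile_ge_half; lra]]).
    assert (H3 := Rpower_pos (/ 2) q). assert (H4 := Rpower_pos x N).
    cut (Rpower x N * (kappa * Rpower x (l - 1)) * Rpower (/ 2) q / q
         <= Rpower x N * K' x * Rpower (u x) q / q); [lra|].
    apply Rmult_le_compat_r; [left; apply Rinv_0_lt_compat; lra|].
    apply Rmult_le_compat; try lra.
    + repeat apply Rmult_le_pos; lra.
    + apply Rmult_le_compat_l; lra.
  - intros x Hx; assert (H := pohozaev_ge x ltac:(lra)).
    assert (H1 : Rpower x (N + l) <= Rpower x N) by (apply Rpower_decr_exp; lra).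
    nra.
  - apply filterlim_neg_Rpower; lra.
Qed.

(** * Comparison with a bubble *)

Let m := N * (p - 1) / (N - p).
Let G (s : R) := F s * Rpower (u s) (- m) * Rpower s (- N).

Lemma G_pos (s : R) : 0 < s <= S -> 0 < G s.
Proof.
  intros Hs; repeat apply Rmult_lt_0_compat; try apply Rpower_pos.
  apply F_pos, Hs.
Qed.

(** The logarithmic derivative is [F'/F + m w/u - N/s]; multiplied by [s F u / q] it is exactly [P],
    since [m/q = (p-1)/p] and [N/q = (N-p)/p]. *)
Lemma is_derive_G (s : R) :
  0 < s <= S -> is_derive G s (G s * (q * P s / (s * F s * u s))).
Proof.
  intros Hs; assert (Ha := inv_p1_pos); assert (Hq := q_gt_p).
  assert (HF0 := F_pos s Hs). assert (Hu0 := u_pos s Hs).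
  eapply is_derive_eq.
  - apply is_derive_Rmult; [apply is_derive_Rmult|].
    + apply hF, Hs.
    + apply is_derive_Rpower; [apply hu, Hs|exact Hu0].
    + apply is_derive_Rpower_id; lra.
  - unfold G, P; fold a q; fold (w s).
    rewrite (Rpower_pred (u s) q), (Rpower_pred s N) by lra.
    set (W := w s); set (U := Rpower (u s) (q - 1)); set (Y := Rpower s (N - 1)).
    set (X := Rpower s (- N)) in *. set (V := Rpower (u s) (- m)).
    unfold m, a, q; field; repeat split; try lra; nra.
Qed.

(** On the core this follows from [flux_ge] and [u <= 1]; beyond [eps] the sign of [P] makes [G]
    nondecreasing. *)
Lemma G_ge (s : R) : 0 < s <= S -> c1 <= G s.
Proof.
  intros Hs; assert (Hq := q_gt_p); assert (He := eps_pos); assert (He1 := eps_le_1).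
  assert (Hsmall : forall x, 0 < x <= eps -> c1 <= G x).
  { intros x Hx; assert (Hc := c1_pos).
    assert (Hf := flux_ge x Hx).
    assert (Hv : 1 <= Rpower (u x) (- m)).
    { assert (Hm : 0 < m) by (apply Rdiv_lt_0_compat; nra).
      rewrite Rpower_Ropp, <- Rinv_1.
      apply Rinv_le_contravar; [apply Rpower_pos|].
      apply Rpower_le_1; [lra|split; [apply u_pos|apply profile_le_1]; lra]. }
    assert (Hx1 : Rpower x N * Rpower x (- N) = 1).
    { rewrite <- Rpower_plus; replace (N + - N) with 0 by ring; apply Rpower_O; lra. }
    assert (HX := Rpower_pos x (- N)). assert (HN := Rpower_pos x N).
    unfold G; apply Rle_trans with (c1 * Rpower x N * 1 * Rpower x (- N)).
    - right; rewrite Rmult_1_r, Rmult_assoc, Hx1; ring.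
    - apply Rmult_le_compat_r; [lra|].
      apply Rmult_le_compat; try lra; nra. }
  destruct (Rle_lt_dec s eps) as [Hle|Hlt]; [apply Hsmall; lra|].
  apply Rle_trans with (G eps); [apply Hsmall; lra|].
  apply (deriv_nonneg_le G (fun x => G x * (q * P x / (x * F x * u x))));
    [lra| |]; intros x Hx.
  - apply is_derive_G; lra.
  - assert (HG := G_pos x ltac:(lra)). assert (HP := pohozaev_nonneg x ltac:(lra)).
    assert (HF0 := F_pos x ltac:(lra)). assert (Hu0 := u_pos x ltac:(lra)).
    apply Rmult_le_pos; [lra|].
    apply Rmult_le_pos; [apply Rmult_le_pos; lra|].
    left; apply Rinv_0_lt_compat; repeat apply Rmult_lt_0_compat; lra.
Qed.

(** By definition of [G], [F s^(1-N) = G u^m s]; raise this to the power [a], where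
    [m a = N/(N-p) = p/(N-p) + 1], and use [G >= c1]. *)
Lemma slope_ge (s : R) :
  0 < s <= S ->
  Rpower c1 a * Rpower (u s) (p / (N - p) + 1) * Rpower s a <= w s.
Proof.
  intros Hs; assert (Ha := inv_p1_pos); assert (Hc := c1_pos).
  assert (Hu0 := u_pos s Hs). assert (HG := G_pos s Hs).
  assert (Hw : w s = Rpower (G s) a * Rpower (u s) (p / (N - p) + 1) * Rpower s a).
  { replace (p / (N - p) + 1) with (m * a) by (unfold m, a; field; lra).
    rewrite <- Rpower_mult.
    rewrite <- Rpower_base_mult by (assumption || apply Rpower_pos).
    rewrite <- Rpower_base_mult
      by (try apply Rmult_lt_0_compat; try apply Rpower_pos; lra).
    unfold w; f_equal; unfold G.
    replace (F s * Rpower (u s) (- m) * Rpower s (- N) * Rpower (u s) m * s)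
      with (F s * (Rpower (u s) (- m) * Rpower (u s) m) * (s * Rpower s (- N))) by ring.
    rewrite <- Rpower_plus; replace (- m + m) with 0 by ring.
    rewrite Rpower_O, (Rpower_pred s (1 - N)) by lra.
    replace (1 - N - 1) with (- N) by ring; ring. }
  rewrite Hw; repeat (apply Rmult_le_compat_r; [left; apply Rpower_pos|]).
  apply Rle_Rpower_l; [lra|split; [lra|apply G_ge, Hs]].
Qed.

(* For a bubble, [u^(-p/(N-p))] is affine in [s^(p/(p-1)) = s^(a+1)]. *)
Lemma profile_decay (s : R) :
  0 < s <= S -> u s <= C1 * Rpower s (- ((N - p) * a)).
Proof.
  intros Hs; assert (Ha := inv_p1_pos); assert (Hc := c3_pos).
  set (k := p / (N - p)).
  assert (Hk : 0 < k) by (apply Rdiv_lt_0_compat; lra).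
  (* The derivative of [u^(-k)] is [k u^(-k-1) w], which [slope_ge] bounds below by [k c1^a s^a];
     [c3] is the constant left after integration. *)
  assert (H : c3 * Rpower s (a + 1) <= Rpower (u s) (- k)).
  { cut (0 <= Rpower (u s) (- k) - c3 * Rpower s (a + 1)); [lra|].
    apply (limit_le_of_deriv_nonneg
      (fun x => Rpower (u x) (- k) - c3 * Rpower x (a + 1))
      (fun x => k * (Rpower (u x) (- (k + 1)) * w x - Rpower c1 a * Rpower x a))
      (fun x => - (c3 * Rpower x (a + 1)))); try lra.
    - intros x Hx; assert (Hu0 := u_pos x ltac:(lra)); eapply is_derive_eq.
      + apply is_derive_Rminus;
          [apply is_derive_Rpower; [apply hu; lra|exact Hu0]
          |apply is_derive_Rscal, is_derive_Rpower_id; lra].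
      + fold a; fold (w x); rewrite (Rpower_pred x (a + 1)) by lra.
        rewrite (Rpower_pred (u x) (- k)) by lra.
        replace (- k - 1) with (- (k + 1)) by ring.
        replace (a + 1 - 1) with a by ring; unfold c3; fold k; field; lra.
    - intros x Hx; apply Rmult_le_pos; [lra|].
      assert (Hsl := slope_ge x ltac:(lra)); fold k in Hsl.
      assert (Hux := Rpower_pos (u x) (- (k + 1))).
      assert (H1 : Rpower (u x) (- (k + 1)) * Rpower (u x) (k + 1) = 1).
      { rewrite <- Rpower_plus; replace (- (k + 1) + (k + 1)) with 0 by ring.
        apply Rpower_O, u_pos; lra. }
      apply Rmult_le_compat_l with (r := Rpower (u x) (- (k + 1))) in Hsl; [|lra].
      replace (Rpower (u x) (- (k + 1)) *
        (Rpower c1 a * Rpower (u x) (k + 1) * Rpower x a))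
        with (Rpower (u x) (- (k + 1)) * Rpower (u x) (k + 1)
              * (Rpower c1 a * Rpower x a)) in Hsl by ring.
      rewrite H1 in Hsl; lra.
    - intros x Hx; assert (H := Rpower_pos (u x) (- k)); lra.
    - apply filterlim_neg_Rpower; lra. }
  replace (u s) with (Rpower (Rpower (u s) (- k)) (- ((N - p) / p))).
  2:{ rewrite Rpower_mult; replace (- k * - ((N - p) / p)) with 1
        by (unfold k; field; lra); apply Rpower_1, u_pos, Hs. }
  apply Rle_trans with (Rpower (c3 * Rpower s (a + 1)) (- ((N - p) / p))).
  - apply Rpower_le_neg.
    + assert (0 < (N - p) / p) by (apply Rdiv_lt_0_compat; lra); lra.
    + split; [apply Rmult_lt_0_compat; [lra|apply Rpower_pos]|exact H].
  (* The exponent of [s] simplifies through [(a+1)/p = a]. *)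
  - right; rewrite Rpower_base_mult by (assumption || apply Rpower_pos).
    unfold C1; f_equal; rewrite Rpower_mult; f_equal; unfold a; field; lra.
Qed.

Lemma profile_pow_decay (s b : R) :
  0 <= b -> 0 < s <= S ->
  Rpower (u s) b <= Rpower C1 b * Rpower s (- ((N - p) * a * b)).
Proof.
  intros Hb Hs; replace (- ((N - p) * a * b)) with (- ((N - p) * a) * b) by ring.
  rewrite <- Rpower_mult, <- Rpower_base_mult by apply Rpower_pos.
  apply Rle_Rpower_l; [lra|split; [apply u_pos, Hs|apply profile_decay, Hs]].
Qed.

(** * Estimates at the far end [S] *)

(** The decay of [u] bounds [F'] by a multiple of [s^(-pa-1)], which is integrable at infinity;
    hence the bound does not depend on [S]. *)
Lemma flux_bound : F S <= C2.
Proof.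
  assert (Ha := inv_p1_pos); assert (Hq := q_gt_p).
  assert (He := eps_pos); assert (He1 := eps_le_1).
  assert (Hpa : 0 < p * a) by (apply Rmult_lt_0_compat; lra).
  set (c := M * Rpower C1 (q - 1) / (p * a)).
  assert (HC1 := Rpower_pos C1 (q - 1)).
  assert (Hc : 0 < c) by (apply Rdiv_lt_0_compat; nra).
  assert (H : - F eps - c * Rpower eps (- (p * a)) <= - F S - c * Rpower S (- (p * a))).
  { apply (deriv_nonneg_le (fun x => - F x - c * Rpower x (- (p * a)))
      (fun x => M * (Rpower C1 (q - 1) * Rpower x (- (p * a) - 1))
                - K x * (Rpower x (N - 1) * Rpower (u x) (q - 1)))); [lra| |].
    - intros x Hx; eapply is_derive_eq.
      + apply is_derive_Rminus; [apply (is_derive_opp F), hF; lra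
          |apply is_derive_Rscal, is_derive_Rpower_id; lra].
      + fold q; rewrite (Rpower_pred x (- (p * a))) by lra.
        unfold opp; simpl; unfold c; field; lra.
    - intros x Hx.
      assert (HK0 := K_bounds x ltac:(lra)).
      assert (Hx1 := Rpower_pos x (N - 1)). assert (Hx2 := Rpower_pos (u x) (q - 1)).
      cut (K x * (Rpower x (N - 1) * Rpower (u x) (q - 1))
        <= M * (Rpower C1 (q - 1) * Rpower x (- (p * a) - 1))); [lra|].
      apply Rmult_le_compat; try lra; [apply Rmult_le_pos; lra|].
      replace (- (p * a) - 1) with (N - 1 + - ((N - p) * a * (q - 1)))
        by (unfold a, q; field; lra).
      rewrite Rpower_plus.
      replace (Rpower C1 (q - 1) *
        (Rpower x (N - 1) * Rpower x (- ((N - p) * a * (q - 1)))))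
        with (Rpower x (N - 1) *
          (Rpower C1 (q - 1) * Rpower x (- ((N - p) * a * (q - 1))))) by ring.
      apply Rmult_le_compat_l; [lra|apply profile_pow_decay; lra]. }
  assert (HF := flux_le eps ltac:(lra)).
  assert (HS := Rpower_pos S (- (p * a))).
  unfold C2; fold c; nra.
Qed.

(** Confronts the lower bound for [P S] coming from the core with an upper bound coming from decay,
    in which the negative term of [P] is dropped. *)
Lemma profile_estimate :
  kappa * c2 <= (C2 * Rpower C2 a / (1 + a) + M * Rpower C1 q / q)
                * Rpower S (- ((N - p) * a)).
Proof.
  assert (Ha := inv_p1_pos); assert (Hq := q_gt_p).
  assert (HFS := flux_bound). assert (HF0 := F_pos S ltac:(lra)).
  assert (Hu0 := u_pos S ltac:(lra)). assert (HK0 := K_bounds S ltac:(lra)).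
  assert (HSN := Rpower_pos S N).
  apply Rle_trans with (P S); [exact pohozaev_lower|].
  assert (Hw : w S <= Rpower C2 a * Rpower S ((1 - N) * a)).
  { rewrite <- Rpower_mult, <- Rpower_base_mult by (lra || apply Rpower_pos).
    apply Rle_Rpower_l; [lra|split].
    - apply Rmult_lt_0_compat; [lra|apply Rpower_pos].
    - apply Rmult_le_compat_r; [left; apply Rpower_pos|lra]. }
  assert (H1 : S * F S * w S / (1 + a)
               <= C2 * Rpower C2 a / (1 + a) * Rpower S (- ((N - p) * a))).
  { replace (- ((N - p) * a)) with (1 + (1 - N) * a) by (unfold a; field; lra).
    rewrite Rpower_plus, Rpower_1 by lra.
    replace (C2 * Rpower C2 a / (1 + a) * (S * Rpower S ((1 - N) * a)))
      with (S * C2 * (Rpower C2 a * Rpower S ((1 - N) * a)) / (1 + a)) by (field; lra).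
    apply Rmult_le_compat_r; [left; apply Rinv_0_lt_compat; lra|].
    apply Rmult_le_compat; [nra|left; apply w_pos| |exact Hw].
    apply Rmult_le_compat_l; lra. }
  assert (H2 : Rpower S N * K S * Rpower (u S) q / q
               <= M * Rpower C1 q / q * Rpower S (- ((N - p) * a))).
  { assert (Hd := profile_pow_decay S q ltac:(lra) ltac:(lra)).
    assert (HC := Rpower_pos C1 q). assert (Huq := Rpower_pos (u S) q).
    (* The left side equals [S^(-Na)], which is even smaller than needed because [S >= 1]. *)
    assert (Hpw : Rpower S N * Rpower S (- ((N - p) * a * q))
                  <= Rpower S (- ((N - p) * a))).
    { rewrite <- Rpower_plus; apply Rle_Rpower; [lra|].
      replace (N + - ((N - p) * a * q)) with (- (N * a)) by (unfold a, q; field; lra).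
      nra. }
    replace (M * Rpower C1 q / q * Rpower S (- ((N - p) * a)))
      with (M * (Rpower C1 q * Rpower S (- ((N - p) * a))) / q) by (field; lra).
    apply Rmult_le_compat_r; [left; apply Rinv_0_lt_compat; lra|].
    replace (Rpower S N * K S * Rpower (u S) q)
      with (K S * (Rpower S N * Rpower (u S) q)) by ring.
    apply Rmult_le_compat; try lra; [apply Rmult_le_pos; lra|].
    apply Rle_trans with
      (Rpower C1 q * (Rpower S N * Rpower S (- ((N - p) * a * q)))).
    - replace (Rpower C1 q * (Rpower S N * Rpower S (- ((N - p) * a * q))))
        with (Rpower S N * (Rpower C1 q * Rpower S (- ((N - p) * a * q)))) by ring.
      apply Rmult_le_compat_l; lra.
    - apply Rmult_le_compat_l; lra. }
  assert (H3 : 0 < (N - p) / p * F S * u S).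
  { repeat apply Rmult_lt_0_compat; try lra; apply Rinv_0_lt_compat; lra. }
  unfold P; lra.
Qed.

End Profile.


(** The order of quantifiers is the point: [C] is fixed before [S] and [kappa], so it survives a
    dilation that sends [S] to infinity and [kappa] to [0]. *)
Lemma profile_bound :
  exists C, 0 < C /\
  forall (S kappa : R) (u F K K' : R -> R),
    1 <= S -> 0 < kappa ->
    (forall s, 0 < s <= S ->
       is_derive u s (- Rpower (F s * Rpower s (1 - N)) (/ (p - 1)))) ->
    (forall s, 0 < s <= S -> is_derive F s
       (Rpower s (N - 1) * K s * Rpower (u s) (N * p / (N - p) - 1))) ->
    (forall s, 0 < s <= S -> is_derive K s (K' s)) ->
    (forall s, 0 < s <= S -> 0 < u s) ->
    (forall s, 0 < s <= S -> 0 < F s) ->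
    (forall s, 0 < s <= S -> A <= K s <= M) ->
    (forall s, 0 < s <= S -> kappa * Rpower s (l - 1) <= K' s) ->
    filterlim u (at_right 0) (locally 1) ->
    filterlim F (at_right 0) (locally 0) ->
    kappa <= C * Rpower S (- ((N - p) / (p - 1))).
Proof.
  assert (Ha := inv_p1_pos); assert (Hq := q_gt_p); assert (Hc2 := c2_pos).
  assert (HC2 : 0 < C2).
  { apply Rplus_lt_0_compat; [|apply Rmult_lt_0_compat; [|apply Rpower_pos]].
    - apply Rmult_lt_0_compat; [apply Rdiv_lt_0_compat; lra|apply Rpower_pos].
    - apply Rdiv_lt_0_compat; apply Rmult_lt_0_compat; try apply Rpower_pos; lra. }
  exists ((C2 * Rpower C2 a / (1 + a) + M * Rpower C1 q / q) / c2); split.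
  - apply Rdiv_lt_0_compat; [|exact Hc2].
    apply Rplus_lt_0_compat; apply Rdiv_lt_0_compat; try lra;
      apply Rmult_lt_0_compat; try apply Rpower_pos; lra.
  - intros S kappa u F K K' HS Hk Hu HF HK Hu0 HF0 HKb HK' Hul HFl.
    assert (H := profile_estimate S kappa u F K K' HS Hk Hu HF HK Hu0 HF0 HKb HK' Hul HFl).
    apply Rmult_le_reg_r with c2; [exact Hc2|].
    eapply Rle_trans; [exact H|right].
    change ((N - p) / (p - 1)) with ((N - p) * a); field; lra.
Qed.

End Normalized.

(** * Dilation to a normalized profile *)

Lemma filterlim_at_right_scal (f : R -> R) (c x : R) :
  0 < c -> filterlim f (at_right 0) (locally x) ->
  filterlim (fun s => f (c * s)) (at_right 0) (locally x).
Proof.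
  intros Hc Hf; eapply filterlim_comp; [|exact Hf].
  intros Q [e He].
  assert (Hec : 0 < e / c) by (apply Rdiv_lt_0_compat; [apply cond_pos|lra]).
  exists (mkposreal _ Hec); intros s Hs Hs0.
  change (Rabs (s - 0) < e / c) in Hs; rewrite Rminus_0_r, Rabs_pos_eq in Hs by lra.
  apply He; [|nra].
  change (Rabs (c * s - 0) < e); rewrite Rminus_0_r, Rabs_pos_eq by nra.
  apply Rmult_lt_compat_l with (r := c) in Hs; [|lra].
  replace (c * (e / c)) with (pos e) in Hs by (field; lra); exact Hs.
Qed.

Lemma filterlim_Rscal (f : R -> R) (c x : R) :
  filterlim f (at_right 0) (locally x) ->
  filterlim (fun s => c * f s) (at_right 0) (locally (c * x)).
Proof.
  intros Hf; eapply filterlim_comp; [exact Hf|apply (filterlim_scal_r c x)].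
Qed.

Lemma is_derive_dilation (f : R -> R) (c s df : R) :
  is_derive f (c * s) df -> is_derive (fun x => f (c * x)) s (c * df).
Proof.
  intros Hf; eapply is_derive_eq.
  - apply (is_derive_comp f (fun x => c * x)); [exact Hf|].
    apply is_derive_Rscal, (is_derive_id (K := R_AbsRing)).
  - unfold scal, one; simpl; unfold mult; simpl; ring.
Qed.

(** With dilation factor [lam], the normalized data are [S = rho / lam] and [kappa = c lam^l]. The
    profile bound then reads [c lam^l <= C rho^(-e) lam^e], which fails for small [lam] because
    [l < e]. *)
Lemma no_large_positive_profile (N p A M l c rho : R) :
  1 < p -> p < N -> 0 < A -> A <= M -> 0 < l -> l < (N - p) / (p - 1) ->
  0 < c -> 0 < rho ->
  exists D, 0 < D /\
  forall (d : R) (u F K K' : R -> R), D < d ->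
    (forall s, 0 < s <= rho ->
       is_derive u s (- Rpower (F s * Rpower s (1 - N)) (/ (p - 1)))) ->
    (forall s, 0 < s <= rho -> is_derive F s
       (Rpower s (N - 1) * K s * Rpower (u s) (N * p / (N - p) - 1))) ->
    (forall s, 0 < s <= rho -> is_derive K s (K' s)) ->
    (forall s, 0 < s <= rho -> 0 < u s) ->
    (forall s, 0 < s <= rho -> 0 < F s) ->
    (forall s, 0 < s <= rho -> A <= K s <= M) ->
    (forall s, 0 < s <= rho -> c * Rpower s (l - 1) <= K' s) ->
    filterlim u (at_right 0) (locally d) ->
    filterlim F (at_right 0) (locally 0) ->
    False.
Proof.
  intros Hp HpN HA HAM Hl Hle Hc Hrho.
  destruct (profile_bound N p A M l Hp HpN HA HAM Hl) as [C [HC Hbound]].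
  set (e := (N - p) / (p - 1)) in *.
  (* [y0] is the value of [lam] at which the two sides of the final inequality balance; taking
     [y <= rho] as well ensures [S >= 1]. *)
  set (y0 := Rpower (c * Rpower rho e / C) (/ (e - l))).
  assert (Hy0 : 0 < y0) by apply Rpower_pos.
  set (y := Rmin rho y0).
  assert (Hy : 0 < y) by (apply Rmin_glb_lt; assumption).
  assert (Hyr : y <= rho) by apply Rmin_l. assert (Hyy : y <= y0) by apply Rmin_r.
  (* This is the amplitude whose dilation factor is [y], so a larger [d] gives [lam < y]. *)
  exists (Rpower y (- ((N - p) / p))); split; [apply Rpower_pos|].
  intros d u F K K' Hd Hu HF HK Hu0 HF0 HKb HK' Hul HFl.
  assert (Hd0 : 0 < d) by (eapply Rlt_trans; [apply Rpower_pos|exact Hd]).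
  set (lam := Rpower d (- (p / (N - p)))).
  assert (Hlam : 0 < lam) by apply Rpower_pos.
  assert (Hlamy : lam < y).
  { assert (H : Rpower (Rpower y (- ((N - p) / p))) (p / (N - p)) < Rpower d (p / (N - p))).
    { apply Rlt_Rpower_l; [apply Rdiv_lt_0_compat; lra|split; [apply Rpower_pos|exact Hd]]. }
    rewrite Rpower_mult in H.
    replace (- ((N - p) / p) * (p / (N - p))) with (- (1)) in H by (field; lra).
    rewrite Rpower_Ropp, Rpower_1 in H by lra.
    unfold lam; rewrite Rpower_Ropp, <- (Rinv_inv y).
    apply Rinv_lt_contravar; [|exact H].
    apply Rmult_lt_0_compat; [apply Rinv_0_lt_compat; lra|apply Rpower_pos]. }
  assert (Hin : forall s, 0 < s <= rho / lam -> 0 < lam * s <= rho).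
  { intros s Hs; split; [nra|].
    replace rho with (lam * (rho / lam)) by (field; lra).
    apply Rmult_le_compat_l; lra. }
  (* The next two identities say that [u(lam s) / d] and [d F(lam s)] solve the same system: the
     first matches the slope equation, the second the flux equation. *)
  assert (Hflux : / d * lam * Rpower (Rpower lam (1 - N)) (/ (p - 1))
                  = Rpower d (/ (p - 1))).
  { rewrite <- (Rpower_1 d) at 1 by lra; rewrite <- Rpower_Ropp; unfold lam.
    rewrite !Rpower_mult, <- !Rpower_plus; f_equal; field; lra. }
  assert (Hsource : d * lam * Rpower lam (N - 1) = Rpower (/ d) (N * p / (N - p) - 1)).
  { rewrite <- (Rpower_1 d) at 1 2 by lra; rewrite <- Rpower_Ropp; unfold lam.
    rewrite !Rpower_mult, <- !Rpower_plus; f_equal; field; lra. }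
  assert (H : c * Rpower lam l <= C * Rpower (rho / lam) (- e)).
  { apply (Hbound (rho / lam) (c * Rpower lam l) (fun s => / d * u (lam * s))
      (fun s => d * F (lam * s)) (fun s => K (lam * s)) (fun s => lam * K' (lam * s))).
    - apply Rmult_le_reg_r with lam; [lra|].
      replace (rho / lam * lam) with rho by (field; lra); lra.
    - apply Rmult_lt_0_compat; [lra|apply Rpower_pos].
    - intros s Hs; eapply is_derive_eq.
      + apply is_derive_Rscal, is_derive_dilation, Hu, Hin, Hs.
      + assert (HFs := HF0 _ (Hin s Hs)).
        rewrite (Rpower_base_mult lam s) by lra.
        set (Z := F (lam * s) * Rpower s (1 - N)).
        assert (HZ : 0 < Z) by (apply Rmult_lt_0_compat; [lra|apply Rpower_pos]).
        replace (F (lam * s) * (Rpower lam (1 - N) * Rpower s (1 - N)))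
          with (Rpower lam (1 - N) * Z) by (unfold Z; ring).
        replace (d * F (lam * s) * Rpower s (1 - N)) with (d * Z) by (unfold Z; ring).
        rewrite !(Rpower_base_mult _ Z) by (assumption || apply Rpower_pos).
        rewrite <- Hflux; ring.
    - intros s Hs; eapply is_derive_eq.
      + apply is_derive_Rscal, is_derive_dilation, HF, Hin, Hs.
      + assert (Hus := Hu0 _ (Hin s Hs)).
        rewrite (Rpower_base_mult lam s) by lra.
        rewrite (Rpower_base_mult (/ d)) by (try apply Rinv_0_lt_compat; lra).
        rewrite <- Hsource; ring.
    - intros s Hs; apply is_derive_dilation, HK, Hin, Hs.
    - intros s Hs; apply Rmult_lt_0_compat; [apply Rinv_0_lt_compat, Hd0|apply Hu0, Hin, Hs].
    - intros s Hs; apply Rmult_lt_0_compat; [apply Hd0|apply HF0, Hin, Hs].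
    - intros s Hs; apply HKb, Hin, Hs.
    - intros s Hs; assert (H := HK' _ (Hin s Hs)).
      rewrite (Rpower_base_mult lam s) in H by lra.
      rewrite (Rpower_pred lam l) by lra.
      apply Rmult_le_compat_l with (r := lam) in H; lra.
    - replace 1 with (/ d * d) by (field; lra).
      apply filterlim_Rscal, filterlim_at_right_scal; assumption.
    - rewrite <- (Rmult_0_r d) at 2.
      apply (filterlim_Rscal (fun s => F (lam * s))), filterlim_at_right_scal; assumption. }
  assert (Hlt : Rpower lam (e - l) < c * Rpower rho e / C).
  { replace (c * Rpower rho e / C) with (Rpower y0 (e - l)).
    - apply Rlt_Rpower_l; lra.
    - unfold y0; rewrite Rpower_mult, Rinv_l, Rpower_1; try lra.
      apply Rdiv_lt_0_compat; [apply Rmult_lt_0_compat; [lra|apply Rpower_pos]|lra]. }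
  unfold Rdiv in H; rewrite Rpower_base_mult in H
    by (try apply Rinv_0_lt_compat; lra).
  replace (Rpower (/ lam) (- e)) with (Rpower lam l * Rpower lam (e - l)) in H.
  2:{ rewrite <- Rpower_plus; replace (l + (e - l)) with e by ring.
      unfold Rpower; rewrite ln_Rinv by lra; f_equal; ring. }
  rewrite (Rpower_Ropp rho) in H.
  assert (Hr := Rpower_pos rho e). assert (Hll := Rpower_pos lam l).
  apply Rmult_lt_compat_l with (r := Rpower lam l * C / Rpower rho e) in Hlt.
  2:{ apply Rdiv_lt_0_compat; nra. }
  replace (Rpower lam l * C / Rpower rho e * (c * Rpower rho e / C))
    with (c * Rpower lam l) in Hlt by (field; lra).
  replace (C * (/ Rpower rho e * (Rpower lam l * Rpower lam (e - l))))
    with (Rpower lam l * C / Rpower rho e * Rpower lam (e - l)) in H by (field; lra).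
  lra.
Qed.

(** * Behaviour at the origin and the first-order system *)

(** The function [f - c ln] is nondecreasing, so [f] falls to minus infinity at least as fast as
    [c ln s]. *)
Lemma no_limit_of_deriv_ge_inv (f df : R -> R) (c r x : R) :
  0 < c -> 0 < r ->
  (forall s, 0 < s <= r -> is_derive f s (df s)) ->
  (forall s, 0 < s <= r -> c / s <= df s) ->
  ~ filterlim f (at_right 0) (locally x).
Proof.
  intros Hc Hr Hd Hge Hlim.
  (* Below [t] the logarithmic bound forces [f s <= x - 1], contradicting closeness to [x] within
     [1]. *)
  set (t := exp ((x - 1 - f r + c * ln r) / c)).
  assert (Ht : 0 < t) by apply exp_pos.
  assert (Hrt : 0 < Rmin r t) by (apply Rmin_glb_lt; assumption).
  assert (Hr1 := Rmin_l r t). assert (Hr2 := Rmin_r r t).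
  destruct (at_right_0_between _ _ Hrt
    (proj1 (filterlim_locally f x) Hlim (mkposreal 1 Rlt_0_1))) as [s [Hs Hb]].
  change (Rabs (f s - x) < 1) in Hb; apply Rabs_def2 in Hb.
  assert (Hm : f s - c * ln s <= f r - c * ln r).
  { apply (deriv_nonneg_le (fun y => f y - c * ln y) (fun y => df y - c * / y));
      [lra| |]; intros y Hy.
    - apply is_derive_Rminus; [apply Hd; lra|apply is_derive_Rscal, is_derive_ln; lra].
    - assert (H := Hge y ltac:(lra)); unfold Rdiv in H; lra. }
  assert (Hls : ln s <= (x - 1 - f r + c * ln r) / c).
  { rewrite <- (ln_exp ((x - 1 - f r + c * ln r) / c)); apply ln_le; fold t; lra. }
  apply Rmult_le_compat_l with (r := c) in Hls; [|lra].
  replace (c * ((x - 1 - f r + c * ln r) / c)) with (x - 1 - f r + c * ln r) in Hls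
    by (field; lra).
  lra.
Qed.

Lemma signed_pow_pos (m x : R) : 0 < x -> signed_pow m x = Rpower x (m - 1).
Proof.
  intros Hx; unfold signed_pow; rewrite Rabs_pos_eq by lra.
  rewrite (Rpower_pred x (m - 1)) by lra; f_equal; f_equal; ring.
Qed.

Lemma signed_pow_opp (m x : R) : signed_pow m (- x) = - signed_pow m x.
Proof. unfold signed_pow; rewrite Rabs_Ropp; ring. Qed.

Lemma signed_pow_pos_inv (m x : R) : 0 < signed_pow m x -> 0 < x.
Proof. unfold signed_pow; intros H; assert (H1 := Rpower_pos (Rabs x) (m - 2)); nra. Qed.

Lemma slope_of_flux (n : nat) (p s x y : R) :
  (0 < n)%nat -> 1 < p -> 0 < s -> 0 < y -> s ^ (n - 1) * signed_pow p x = y ->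
  x = Rpower (y * Rpower s (1 - INR n)) (/ (p - 1)).
Proof.
  intros Hn Hp Hs Hy H.
  assert (Hs1 := pow_lt s (n - 1) Hs).
  assert (Hx : 0 < x) by (apply (signed_pow_pos_inv p); nra).
  rewrite signed_pow_pos in H by exact Hx.
  rewrite <- (Rpower_pow (n - 1) s Hs), minus_INR in H by lia; simpl (INR 1) in H.
  rewrite <- H, (Rmult_comm (Rpower s _)), Rmult_assoc, <- Rpower_plus.
  replace (INR n - 1 + (1 - INR n)) with 0 by ring.
  rewrite Rpower_O, Rmult_1_r, Rpower_mult, Rinv_r, Rpower_1 by lra; reflexivity.
Qed.

(** Inverting the flux gives a factor [s^(-(n-1)/(p-1))], which dominates [1/s] for [s <= 1] since
    [p < n]. *)
Lemma slope_of_flux_ge (n : nat) (p s x y : R) :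
  (0 < n)%nat -> 1 < p -> p < INR n -> 0 < s <= 1 -> 0 < y ->
  y <= s ^ (n - 1) * signed_pow p x -> Rpower y (/ (p - 1)) / s <= x.
Proof.
  intros Hn Hp HpN Hs Hy H.
  rewrite (slope_of_flux n p s x (s ^ (n - 1) * signed_pow p x)) by (lra || assumption || reflexivity).
  assert (Ha : 0 < / (p - 1)) by (apply Rinv_0_lt_compat; lra).
  apply Rle_trans with (Rpower (y * Rpower s (1 - INR n)) (/ (p - 1))).
  - rewrite Rpower_base_mult by (lra || apply Rpower_pos).
    apply Rmult_le_compat_l; [left; apply Rpower_pos|].
    rewrite <- (Rpower_1 s) at 1 by lra; rewrite <- Rpower_Ropp, Rpower_mult.
    apply Rpower_decr_exp; [|lra].
    apply Rmult_le_reg_r with (p - 1); [lra|].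
    rewrite Rmult_assoc, Rinv_l by lra; lra.
  - apply Rle_Rpower_l; [lra|split].
    + apply Rmult_lt_0_compat; [lra|apply Rpower_pos].
    + apply Rmult_le_compat_r; [left; apply Rpower_pos|exact H].
Qed.

(* The flux vanishes at the origin: otherwise [|u'| >= c / s] near [0], because
   [(n-1)/(p-1) > 1], and [u] would have no limit there. *)
Lemma positive_solution_profile (n : nat) (p d rho : R) (K u : R -> R) :
  (0 < n)%nat -> 1 < p -> p < INR n -> 0 < rho <= 1 ->
  (forall r, 0 < r -> 0 < K r) ->
  regular_solution n p K d u ->
  (forall r, 0 < r <= rho -> 0 < u r) ->
  exists F : R -> R,
    (forall s, 0 < s <= rho ->
       is_derive u s (- Rpower (F s * Rpower s (1 - INR n)) (/ (p - 1)))) /\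
    (forall s, 0 < s <= rho -> is_derive F s
       (Rpower s (INR n - 1) * K s * Rpower (u s) (INR n * p / (INR n - p) - 1))) /\
    (forall s, 0 < s <= rho -> 0 < F s) /\
    filterlim F (at_right 0) (locally 0).
Proof.
  intros Hn Hp HpN Hrho HK [Hu [Heq Hlim]] Hpos.
  set (F := fun s => - (s ^ (n - 1) * signed_pow p (Derive u s))).
  exists F.
  assert (HF : forall s, 0 < s <= rho -> is_derive F s
     (Rpower s (INR n - 1) * K s * Rpower (u s) (INR n * p / (INR n - p) - 1))).
  { intros s Hs; destruct (Heq s ltac:(lra)) as [Hex HE].
    eapply is_derive_eq.
    - apply (is_derive_opp (fun y => y ^ (n - 1) * signed_pow p (Derive u y))).
      apply Derive_correct, Hex.
    - rewrite signed_pow_pos in HE by (apply Hpos, Hs).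
      unfold critical_exponent in HE.
      rewrite <- (Rpower_pow (n - 1) s) in HE by lra.
      rewrite minus_INR in HE by lia; simpl (INR 1) in HE.
      unfold opp; simpl; lra. }
  assert (HF' : forall s, 0 < s <= rho ->
    0 < Rpower s (INR n - 1) * K s * Rpower (u s) (INR n * p / (INR n - p) - 1)).
  { intros s Hs; repeat apply Rmult_lt_0_compat; try apply Rpower_pos; apply HK; lra. }
  assert (Hmono : forall s t, 0 < s -> s < t -> t <= rho -> F s < F t).
  { intros s t Hs Hst Ht; eapply deriv_pos_lt; [exact Hst| |];
      intros x Hx; [apply HF|apply HF']; lra. }
  assert (Hnonneg : forall s, 0 < s <= rho -> 0 <= F s).
  { intros s Hs; apply Rnot_lt_le; intros Hneg.
    (* A negative value [F s] persists towards the origin because [F] increases, so [u' >= c/x] on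
       all of [(0, s]]. *)
    apply (no_limit_of_deriv_ge_inv u (Derive u) (Rpower (- F s) (/ (p - 1))) s d);
      [apply Rpower_pos|lra| | |exact Hlim]; intros x Hx.
    - apply Derive_correct, Hu; lra.
    - apply (slope_of_flux_ge n); try assumption; try lra.
      destruct (Rle_lt_or_eq_dec x s ltac:(lra)) as [Hlt| ->]; [|unfold F; lra].
      assert (H := Hmono x s ltac:(lra) Hlt ltac:(lra)).
      unfold F in H at 1; lra. }
  assert (HFpos : forall s, 0 < s <= rho -> 0 < F s).
  { intros s Hs; apply Rle_lt_trans with (F (s / 2)); [apply Hnonneg; lra|].
    apply Hmono; lra. }
  split; [|split; [exact HF|split; [exact HFpos|]]].
  - intros s Hs; eapply is_derive_eq; [apply Derive_correct, Hu; lra|].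
    rewrite <- (slope_of_flux n p s (- Derive u s) (F s)); try assumption; try lra.
    + apply HFpos, Hs.
    + rewrite signed_pow_opp; unfold F; ring.
  - apply filterlim_locally; intros eps.
    (* Either [F] drops below [eps] once, and monotonicity keeps it there down to [0], or [F >= eps]
       throughout and [-u] diverges logarithmically. *)
    destruct (classic (exists r, 0 < r <= rho /\ F r < eps)) as [[r [Hr Hlt]]|Hno].
    + assert (Hr0 : 0 < r) by lra.
      exists (mkposreal r Hr0); intros s Hs Hs0.
      change (Rabs (s - 0) < r) in Hs; rewrite Rminus_0_r, Rabs_pos_eq in Hs by lra.
      change (Rabs (F s - 0) < eps).
      rewrite Rminus_0_r, Rabs_pos_eq by (apply Hnonneg; lra).
      assert (H := Hmono s r Hs0 Hs ltac:(lra)); lra.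
    + exfalso.
      apply (no_limit_of_deriv_ge_inv (fun x => - u x) (fun x => - Derive u x)
        (Rpower eps (/ (p - 1))) rho (- d)); [apply Rpower_pos|lra| | |].
      * intros s Hs; apply (is_derive_opp u), Derive_correct, Hu; lra.
      * intros s Hs; apply (slope_of_flux_ge n); try assumption; try lra;
          [apply cond_pos|].
        rewrite signed_pow_opp.
        apply Rnot_lt_le; intros Hlt; apply Hno; exists s; split; [exact Hs|].
        unfold F; lra.
      * apply filterlim_opp, Hlim.
Qed.

(** * Zeros of a solution *)

Lemma first_zero_exists (v : R -> R) (d z : R) :
  0 < d -> (forall r, 0 < r -> ex_derive v r) ->
  filterlim v (at_right 0) (locally d) -> 0 < z -> v z = 0 ->
  exists r, is_first_zero v r.
Proof.
  intros Hd Hv Hlim Hz Hvz.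
  destruct (proj1 (filterlim_locally v d) Hlim (mkposreal d Hd)) as [e He].
  assert (He0 := cond_pos e).
  assert (Hlow : forall x, 0 < x -> v x = 0 -> e <= x).
  { intros x Hx Hvx; apply Rnot_lt_le; intros Hlt.
    assert (H : ball d d (v x)).
    { apply He; [|exact Hx].
      change (Rabs (x - 0) < e); rewrite Rminus_0_r, Rabs_pos_eq; lra. }
    change (Rabs (v x - d) < d) in H; apply Rabs_def2 in H; lra. }
  (* The zeros are reflected so that their infimum becomes a supremum; the limit [d > 0] keeps them
     at distance at least [e] from the origin. *)
  set (E := fun y => 0 < - y /\ v (- y) = 0).
  destruct (completeness E) as [b [Hub Hleast]].
  - exists 0; intros y [Hy _]; lra.
  - exists (- z); split; rewrite Ropp_involutive; assumption.
  - assert (Hb : b <= - e).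
    { apply Hleast; intros y [Hy Hvy]; assert (H := Hlow _ Hy Hvy); lra. }
    exists (- b); split; [lra|split].
    + apply NNPP; intros Hne.
      assert (Hc : continuous v (- b)) by (apply (ex_derive_continuous v), Hv; lra).
      assert (Habs : 0 < Rabs (v (- b))) by (apply Rabs_pos_lt, Hne).
      destruct (proj1 (filterlim_locally v (v (- b))) Hc (mkposreal _ Habs)) as [g Hg].
      assert (Hg0 := cond_pos g).
      (* If [v] did not vanish at [- b], continuity would exclude zeros within [g] of it, making
         [b - g] a smaller upper bound. *)
      assert (H : b <= b - g); [|lra].
      apply Hleast; intros y [Hy Hvy]; apply Rnot_lt_le; intros Hlt.
      assert (Hyb := Hub y (conj Hy Hvy)).
      assert (Hball : ball (v (- b)) (Rabs (v (- b))) (v (- y))).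
      { apply Hg; change (Rabs (- y - - b) < g); rewrite Rabs_pos_eq; lra. }
      change (Rabs (v (- y) - v (- b)) < Rabs (v (- b))) in Hball.
      rewrite Hvy in Hball; unfold Rminus in Hball.
      rewrite Rplus_0_l, Rabs_Ropp in Hball; lra.
    + intros s Hs Hvs.
      assert (H : - s <= b) by (apply Hub; split; rewrite Ropp_involutive; lra).
      lra.
Qed.

Lemma pos_of_no_zero (v : R -> R) (d rho : R) :
  0 < d -> (forall r, 0 < r -> ex_derive v r) ->
  filterlim v (at_right 0) (locally d) ->
  (forall r, 0 < r <= rho -> v r <> 0) ->
  forall r, 0 < r <= rho -> 0 < v r.
Proof.
  intros Hd Hv Hlim Hnz r Hr; apply Rnot_le_lt; intros Hle.
  assert (Hlt : v r < 0) by (assert (H := Hnz r Hr); lra).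
  destruct (at_right_0_between _ r ltac:(lra)
    (proj1 (filterlim_locally v d) Hlim (mkposreal d Hd))) as [s [Hs Hb]].
  change (Rabs (v s - d) < d) in Hb; apply Rabs_def2 in Hb.
  assert (Hsr : s < r).
  { destruct (Rle_lt_or_eq_dec s r ltac:(lra)) as [H|H]; [exact H|subst; lra]. }
  destruct (IVT_interv (fun x => - v x) s r) as [z [Hz Hvz]]; try lra.
  - intros x Hx; apply continuity_pt_opp, derivable_continuous_pt.
    exists (Derive v x); apply is_derive_Reals, Derive_correct, Hv; lra.
  - apply (Hnz z); lra.
Qed.

(** * The potential near the origin *)

Lemma potential_near_0 (K h : R -> R) (A B l : R) :
  C1_on (fun r => 0 <= r) K -> 0 < B -> 0 < l ->
  (forall r, 0 < r -> K r = A + B * Rpower r l + h r) ->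
  filterlim (fun r => (Rabs (h r) + r * Rabs (Derive h r)) / Rpower r l)
    (at_right 0) (locally 0) ->
  exists (rho : R) (K' : R -> R), 0 < rho <= 1 /\
  forall r, 0 < r <= rho ->
    is_derive K r (K' r) /\ A <= K r <= A + 2 * B /\
    B * l / 2 * Rpower r (l - 1) <= K' r.
Proof.
  intros [k Hk] HB Hl HK Hh.
  (* The bound [B] on the relative size of [h] yields [A <= K <= A + 2 B]; the bound [B l / 2] on
     that of [r h'] leaves half of the derivative of [B r^l]. *)
  assert (Heta : 0 < Rmin B (B * l / 2)) by (apply Rmin_glb_lt; nra).
  assert (He1 := Rmin_l B (B * l / 2)). assert (He2 := Rmin_r B (B * l / 2)).
  set (eta := Rmin B (B * l / 2)) in *.
  destruct (proj1 (filterlim_locally _ _) Hh (mkposreal eta Heta)) as [g Hg].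
  assert (Hg0 := cond_pos g).
  exists (Rmin 1 (g / 2)), (fun r => B * (l * (Rpower r l / r)) + Derive h r).
  assert (Hm1 := Rmin_l 1 (g / 2)). assert (Hm2 := Rmin_r 1 (g / 2)).
  assert (Hm3 : 0 < Rmin 1 (g / 2)) by (apply Rmin_glb_lt; lra).
  split; [lra|]; intros r Hr.
  assert (Hrl := Rpower_pos r l).
  assert (Hball : ball 0 eta ((Rabs (h r) + r * Rabs (Derive h r)) / Rpower r l)).
  { apply (Hg r); [|lra]; change (Rabs (r - 0) < g).
    rewrite Rminus_0_r, Rabs_pos_eq; lra. }
  change (Rabs ((Rabs (h r) + r * Rabs (Derive h r)) / Rpower r l - 0) < eta) in Hball.
  rewrite Rminus_0_r in Hball; apply Rabs_def2 in Hball; destruct Hball as [Hsum _].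
  apply Rmult_lt_compat_r with (r := Rpower r l) in Hsum; [|lra].
  replace ((Rabs (h r) + r * Rabs (Derive h r)) / Rpower r l * Rpower r l)
    with (Rabs (h r) + r * Rabs (Derive h r)) in Hsum by (field; lra).
  assert (Hh0 := Rabs_pos (h r)). assert (Hd0 := Rabs_pos (Derive h r)).
  assert (Hhr : Rabs (h r) <= eta * Rpower r l) by nra.
  assert (Hdr : r * Rabs (Derive h r) <= eta * Rpower r l) by nra.
  apply Rabs_le_between in Hhr.
  assert (Hr1 : Rpower r l <= 1) by (apply Rpower_le_1; lra).
  split; [|split].
  - assert (HKd : is_derive K r (k r)).
    (* At an interior point the derivative relative to the half-line is two-sided; increments
       smaller than [r] stay in the domain. *)
    { apply is_derive_Reals; intros eps Heps.
      destruct (proj1 (Hk r ltac:(lra)) eps Heps) as [al [Hal Hal2]].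
      assert (Hmin : 0 < Rmin al r) by (apply Rmin_glb_lt; lra).
      exists (mkposreal _ Hmin); intros y Hy0 Hy; simpl in Hy.
      assert (H1 := Rmin_l al r). assert (H2 := Rmin_r al r).
      assert (Hy2 := Rabs_def2 y r ltac:(lra)).
      specialize (Hal2 (r + y)); simpl in Hal2; unfold Rdist in Hal2.
      replace (r + y - r) with y in Hal2 by ring.
      apply Hal2; split; [split; [lra|intros Heq; apply Hy0; lra]|lra]. }
    (* Differentiability of [h] is inherited from [K], so [Derive h r] is a true derivative and not
       a default value. *)
    assert (Hhd : is_derive h r (k r - B * (l * (Rpower r l / r)))).
    { apply (is_derive_ext_loc (fun y => K y - A - B * Rpower y l)).
      - assert (Hr0 : 0 < r) by lra.
        exists (mkposreal r Hr0); intros y Hy.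
        change (Rabs (y - r) < r) in Hy; apply Rabs_def2 in Hy.
        rewrite HK by lra; change (A + B * Rpower y l + h y - A - B * Rpower y l = h y); ring.
      - eapply is_derive_eq.
        + apply is_derive_Rminus;
            [apply is_derive_Rminus; [exact HKd|apply (is_derive_const A)]
            |apply is_derive_Rscal, is_derive_Rpower_id; lra].
        + unfold zero; simpl; ring. }
    rewrite (is_derive_unique _ _ _ Hhd).
    eapply is_derive_eq; [exact HKd|ring].
  - rewrite HK by lra; nra.
  - assert (Hpr := Rpower_pred r l ltac:(lra)).
    assert (Hpp := Rpower_pos r (l - 1)).
    rewrite Hpr in Hdr |- *.
    replace (r * Rpower r (l - 1) / r) with (Rpower r (l - 1)) by (field; lra).
    assert (Hdr2 : Rabs (Derive h r) <= eta * Rpower r (l - 1)) by nra.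
    apply Rabs_le_between in Hdr2; nra.
Qed.

(** * Crossing for large [d] and the limit of the first zero *)

Theorem proposition37 (n : nat) (p : R) (K : R -> R) (u : R -> R -> R)
    (A B l : R) (h : R -> R)
    (hn : (0 < n)%nat) (hp1 : 1 < p) (hpn : p < INR n)
    (hp_low : 2 * INR n / (INR n + 2) <= p) (hp_up : p <= 2)
    (hKpos : forall r, 0 <= r -> 0 < K r)
    (hKC1 : C1_on (fun r => 0 <= r) K)
    (hu : forall d, 0 < d -> regular_solution n p K d (u d))
    (hA : 0 < A) (hB : 0 < B)
    (hl0 : 0 < l) (hl1 : l < (INR n - p) / (p - 1))
    (hK : forall r, 0 < r -> K r = A + B * Rpower r l + h r)
    (hh : filterlim (fun r => (Rabs (h r) + r * Rabs (Derive h r)) / Rpower r l)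
            (at_right 0) (locally 0)) :
  exists Dhat : R,
    0 < Dhat /\
    (forall d, Dhat < d -> crossing_set u d) /\
    is_lim (first_zero u) p_infty 0.
Proof.
  destruct (potential_near_0 K h A B l hKC1 hB hl0 hK hh) as [rho0 [K' [Hrho0 HK']]].
  (* Both conclusions come from this: [rho = rho0] gives crossing, and arbitrarily small [rho]
     forces the first zero to [0]. *)
  assert (Hzero : forall rho, 0 < rho <= rho0 -> exists D, 0 < D /\
    forall d, D < d -> exists r, 0 < r <= rho /\ u d r = 0).
  { intros rho Hrho.
    destruct (no_large_positive_profile (INR n) p A (A + 2 * B) l (B * l / 2) rho)
      as [D [HD Hno]]; try lra; [nra|].
    exists D; split; [exact HD|]; intros d Hd.
    apply NNPP; intros Hnz.
    assert (Hreg := hu d ltac:(lra)); destruct Hreg as [Hu [Heq Hlim]].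
    assert (Hpos : forall r, 0 < r <= rho -> 0 < u d r).
    { apply (pos_of_no_zero (u d) d rho); try assumption; [lra|].
      intros r Hr Hur; apply Hnz; exists r; split; assumption. }
    destruct (positive_solution_profile n p d rho K (u d))
      as [F [HuF [HF [HF0 HFl]]]]; try assumption; try lra.
    - intros r Hr; apply hKpos; lra.
    - apply hu; lra.
    - apply (Hno d (u d) F K K'); try assumption; intros s Hs;
        destruct (HK' s ltac:(lra)) as [HKd [HKb HKl]]; assumption. }
  destruct (Hzero rho0 ltac:(lra)) as [D [HD HDz]].
  exists D; split; [exact HD|split].
  - intros d Hd; split; [lra|].
    destruct (HDz d Hd) as [r [Hr Hur]]; exists r; split; [lra|exact Hur].
  - apply is_lim_spec; intros eps.
    assert (He := cond_pos eps).
    assert (Hm : 0 < Rmin rho0 (eps / 2)) by (apply Rmin_glb_lt; lra).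
    assert (Hm1 := Rmin_l rho0 (eps / 2)). assert (Hm2 := Rmin_r rho0 (eps / 2)).
    destruct (Hzero (Rmin rho0 (eps / 2)) ltac:(lra)) as [D' [HD' HDz']].
    exists D'; intros d Hd.
    destruct (HDz' d Hd) as [z [Hz Huz]].
    destruct (hu d ltac:(lra)) as [Hu [_ Hlim]].
    (* The choice operator is meaningful only once a least positive zero is known to exist. *)
    assert (Hfz : is_first_zero (u d) (first_zero u d)).
    { apply (epsilon_spec (inhabits 0) (is_first_zero (u d))).
      apply (first_zero_exists (u d) d z); try assumption; lra. }
    destruct Hfz as [Hf0 [_ Hfmin]].
    rewrite Rminus_0_r, Rabs_pos_eq by lra.
    apply Rle_lt_trans with z; [|lra].
    apply Rnot_lt_le; intros Hlt; apply (Hfmin z); lra.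
Qed.
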